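(* Let $D$ be a bipartite tournament (an orientation of a complete bipartite graph $K_{m,n}$ with $m,n\ge 1$). Then the $(1,2)$-step competition graph $C_{1,2}(D)$ either has at most one non-trivial connected component, or consists of exactly two connected components, each of which is a complete graph on at least three vertices.
   Context: For vertices $x,y$ of a digraph $H$, $d_H(x,y)$ denotes the number of arcs in a shortest directed path from $x$ to $y$ in $H$ (if one exists). The $(1,2)$-step competition graph $C_{1,2}(D)$ of a digraph $D$ is the simple graph with vertex set $V(D)$ in which distinct $u,v$ are adjacent if and only if there is a vertex $w\neq u,v$ such that either $d_{D-v}(u,w)\le 1$ and $d_{D-u}(v,w)\le 2$, or $d_{D-u}(v,w)\le 1$ and $d_{D-v}(u,w)\le 2$. A component is non-trivial if it has at least two vertices. *)

(* Defs.v *)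
From mathcomp Require Import all_boot.
Set Implicit Arguments.
Unset Strict Implicit.
Unset Printing Implicit Defensive.

Section Digraph.
Variable V : finType.
Implicit Types (H D e : rel V) (x y u v w : V) (k : nat).

(* [D] is an orientation of the complete bipartite graph with the two
   nonempty sides [A] and [~: A]; [(+)] is exclusive or. *)
Definition bipartite_tournament D : Prop :=
  exists A : {set V},
    [/\ A != set0, ~: A != set0,
        forall x y, (x \in A) = (y \in A) -> ~~ D x y
      & forall x y, (x \in A) != (y \in A) -> D x y (+) D y x].

(* A directed path (no repeated vertex) with exactly [k] arcs. *)
Definition has_dipath H x y k : bool :=
  [exists p : k.-tuple V, [&& path H x p, last x p == y & uniq (x :: p)]].

(* The distance d_H(x, y) exists and equals [k]. *)
Definition is_dist H x y k : bool :=
  has_dipath H x y k && [forall j : 'I_k, ~~ has_dipath H x y j].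

(* The distance d_H(x, y) exists and is at most [k]. *)
Definition dist_le H x y k : bool := [exists d : 'I_k.+1, is_dist H x y d].

(* H - v.  The vertex [v] stays in the carrier type but is isolated, so this
   has the distances of H - v between vertices other than [v]. *)
Definition del_vertex H v : rel V := [rel x y | [&& H x y, x != v & y != v]].

Definition c12 D : rel V :=
  [rel u v | (u != v) &&
    [exists w, [&& w != u, w != v &
      (dist_le (del_vertex D v) u w 1 && dist_le (del_vertex D u) v w 2)
      || (dist_le (del_vertex D u) v w 1 && dist_le (del_vertex D v) u w 2)]]].

(* Vertex sets of the connected components of the graph with symmetric
   adjacency relation [e]. *)
Definition components e : {set {set V}} :=
  equivalence_partition (connect e) [set: V].

Definition nontrivial_components e : {set {set V}} :=
  [set K in components e | 2 <= #|K|].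

Definition complete_on e (K : {set V}) : Prop :=
  {in K &, forall x y, x != y -> e x y}.

End Digraph.

(* Main.v *)
Require Import Defs.
From mathcomp Require Import all_boot.

(** Let [A] and [~: A] be the sides of [D].  Two vertices of the same side are
adjacent in [C_{1,2}(D)] iff they have a common out-neighbour.  Two vertices
[u], [v] of different sides are adjacent iff [u] has an out-neighbour [y != v]
and [v] has an out-neighbour [x != u]: whichever way the arc between [x] and [y]
points, its head is the required vertex [w].

Call a vertex big if it has two out-neighbours.  If both sides contain a big
vertex, every non-isolated vertex is connected to the big ones.  Otherwise every
vertex [x] of [A], say, has at most one out-neighbour [f x].  A vertex of [~: A]
different from [f x] and [f x'] is adjacent to both [x] and [x'], which gives
connectedness as soon as [~: A] has three vertices.  If a side is a singleton,
the non-isolated vertices form a clique in the other side.  If [~: A = {y1, y2}]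
and some vertex of [A] is a sink, it makes [y1] and [y2] adjacent.  There remains
[~: A = {y1, y2}] with [f] total: the classes [f^-1(y1) + y2] and [f^-1(y2) + y1]
are two cliques if both fibres have at least two elements, and one of them
consists of isolated vertices otherwise. *)

(** * Distances of at most one and two *)

Section Distance.
Variables (V : finType) (H : rel V).
Implicit Types x y : V.

Lemma dist_leE x y k : dist_le H x y k = [exists j : 'I_k.+1, has_dipath H x y j].
Proof.
apply/existsP/existsP => [[d /andP[hd _]]|[j hj]]; first by exists d.
have ex : exists n, has_dipath H x y n by exists j.
case: (ex_minnP ex) => m hm min.
have mk : m < k.+1 := leq_ltn_trans (min _ hj) (ltn_ord j).
exists (Ordinal mk); rewrite /is_dist hm /=.
apply/forallP => i; apply/negP => /min; by rewrite leqNgt ltn_ord.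
Qed.

Lemma has_dipath0 x y : has_dipath H x y 0 = (x == y).
Proof.
apply/existsP/idP => [[p]|hxy]; first by rewrite tuple0 /= andbT.
by exists [tuple]; rewrite /= hxy.
Qed.

Lemma has_dipath1 x y : has_dipath H x y 1 = H x y && (x != y).
Proof.
apply/existsP/idP => [[p]|/andP[hxy nxy]].
  case/tupleP: p => z p; rewrite tuple0 /= !andbT inE.
  by case/and3P => hxz /eqP <- ->; rewrite hxz.
by exists [tuple y]; rewrite /= hxy eqxx inE nxy.
Qed.

Lemma has_dipath2 x y :
  has_dipath H x y 2 = [exists z, [&& H x z, H z y & uniq [:: x; z; y]]].
Proof.
apply/existsP/existsP => [[p]|[z /and3P[h1 h2 h3]]].
  case/tupleP: p => z p; case/tupleP: p => t p; rewrite tuple0 /= andbT.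
  case/and3P => /andP[h1 h2] /eqP e h3; exists z; subst t.
  by rewrite h1 h2.
by exists [tuple z; y]; rewrite [tval _]/= h3 /= h1 h2 eqxx.
Qed.

Lemma dist_le1 x y : x != y -> dist_le H x y 1 = H x y.
Proof.
move=> nxy; rewrite dist_leE; apply/existsP/idP => [[[[|[|//]] ltj] /=]|hxy].
- by rewrite has_dipath0 (negPf nxy).
- by rewrite has_dipath1 => /andP[].
by exists (Ordinal (isT : 1 < 2)); rewrite has_dipath1 hxy.
Qed.

(** Irreflexivity of [H] keeps the middle vertex apart from both ends, so a walk with two arcs
    between distinct vertices is a path. *)
Lemma dist_le2P x y : x != y -> irreflexive H ->
  reflect (H x y \/ exists2 z, H x z & H z y) (dist_le H x y 2).
Proof.
move=> nxy irr; rewrite dist_leE; apply: (iffP existsP).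
  move=> [[[|[|[|//]]] ltj] /=].
  - by rewrite has_dipath0 (negPf nxy).
  - by rewrite has_dipath1 => /andP[]; left.
  - by rewrite has_dipath2 => /existsP[z /and3P[h1 h2 _]]; right; exists z.
case=> [hxy|[z h1 h2]].
  by exists (Ordinal (isT : 1 < 3)); rewrite has_dipath1 hxy.
exists (Ordinal (isT : 2 < 3)); rewrite has_dipath2; apply/existsP; exists z.
rewrite h1 h2 /= !inE negb_or nxy !andbT.
by apply/andP; split; apply/eqP => e; subst z; rewrite irr in h1 h2.
Qed.

End Distance.

(** * Components of a symmetric relation *)

Section Components.
Variables (V : finType) (e : rel V).
Hypothesis e_sym : symmetric e.

Lemma component_eq x y : connect e x y ->
  [set z in [set: V] | connect e x z] = [set z in [set: V] | connect e y z].
Proof.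
move=> cxy; apply/setP => z; rewrite !inE /=.
exact: same_connect (sym_connect_sym e_sym) _ _ cxy _.
Qed.

(** A component with two vertices has a representative with an incident edge; [u'] and [v'] only
    witness that [u] and [v] are not isolated. *)
Lemma nontrivial_components_le1 :
  (forall u v u' v', e u u' -> e v v' -> connect e u v) ->
  #|nontrivial_components e| <= 1.
Proof.
move=> conn; apply/card_le1_eqP => K1 K2; rewrite !inE.
have nbr K : K \in components e -> 1 < #|K| -> exists x x',
    e x x' /\ K = [set z in [set: V] | connect e x z].
  case/imsetP=> x _ -> /card_gt1P[a [b [+ + nab]]]; rewrite !inE /=.
  (* One of the two members differs from the representative [x]; the path from [x] to it starts with
     an edge at [x]. *)
  wlog xa : a b nab / x != a => [wl ca cb|].
    have [ex|nxa] := eqVneq x a; last exact: wl nab nxa ca cb.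
    by apply: wl cb ca; rewrite ?ex // eq_sym.
  case/connectP=> -[|x' p] /=; first by move=> _ ea; rewrite ea eqxx in xa.
  by case/andP=> exx' _ _ _; exists x, x'.
case/andP=> /nbr h1 /h1[x [x' [ex ->]]] /andP[/nbr h2 /h2[y [y' [ey ->]]]].
exact: component_eq _ _ (conn _ _ _ _ ey ex).
Qed.

(** [K] is closed under [e], so connectedness coincides with lying in the same class; [a] and [b]
    ensure that both classes occur. *)
Lemma components_two_cliques (K : {set V}) a b : a \in K -> b \notin K ->
    (forall x y, e x y = (x != y) && ((x \in K) == (y \in K))) ->
  components e = [set K; ~: K].
Proof.
move=> aK bK eE.
have cE x y : connect e x y = ((x \in K) == (y \in K)).
  apply/idP/idP => [|exy].
    have clK : closed e (mem K) by move=> s t /=; rewrite eE => /andP[_ /eqP].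
    by move/(closed_connect clK) ->.
  by have [->|nxy] := eqVneq x y; [exact: connect0 | apply: connect1; rewrite eE nxy].
have cK x : [set z in [set: V] | connect e x z] = if x \in K then K else ~: K.
  by apply/setP => z; rewrite !inE cE; case: (x \in K) => /=;
    rewrite ?inE; case: (z \in K).
apply/setP => K'; rewrite !inE; apply/imsetP/idP.
  by case=> x _ ->; rewrite cK; case: ifP => _; rewrite eqxx ?orbT.
by case/orP=> /eqP ->; [exists a | exists b]; rewrite // cK ?aK ?(negPf bK).
Qed.

End Components.

(** * Adjacency in [c12] for a bipartite tournament *)

Definition bipartition {V : finType} (D : rel V) (A : {set V}) : Prop :=
  (forall x y, (x \in A) = (y \in A) -> ~~ D x y) /\
  (forall x y, (x \in A) != (y \in A) -> D x y (+) D y x).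

Lemma bipartitionC (V : finType) (D : rel V) A :
  bipartition D A -> bipartition D (~: A).
Proof.
case=> same opp; split=> x y; rewrite !inE => h; [apply: same | apply: opp].
  by move/negb_inj: h.
by move: h; case: (x \in A); case: (y \in A).
Qed.

Section Bipartite.
Variables (V : finType) (D : rel V) (A : {set V}).
Hypothesis bipA : bipartition D A.
Implicit Types u v w x y z : V.

Lemma arc_side x y : D x y -> (y \in A) = ~~ (x \in A).
Proof.
by move=> dxy; case: bipA => /(_ x y) + _; rewrite dxy;
  case: (x \in A); case: (y \in A) => // /(_ erefl).
Qed.

Lemma arc_opp x y : (x \in A) != (y \in A) -> D y x = ~~ D x y.
Proof. by case: bipA => _ opp /opp; case: (D x y); case: (D y x). Qed.

Lemma arc_asym x y : D x y -> D y x = false.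
Proof. by move=> dxy; rewrite arc_opp ?dxy // (arc_side _ _ dxy); case: (x \in A). Qed.

Lemma arc_irr : irreflexive D.
Proof. by move=> x; apply/negP => d; move: (arc_asym _ _ d); rewrite d. Qed.

(** Every arc changes sides. Hence two arcs into [w] put [u] and [v] on the same side, while path
    lengths one and two put them on different sides; the deleted vertices turn into the two
    inequalities. *)
Lemma c12P u v : reflect
  (u != v /\
    (((u \in A) = (v \in A) /\ exists2 w, D u w & D v w) \/
     ((u \in A) != (v \in A) /\
      exists x y, [/\ D u y, y != v, D v x & x != u])))
  (c12 D u v).
Proof.
have delE z x y : del_vertex D z x y = [&& D x y, x != z & y != z] by [].
have irr z : irreflexive (del_vertex D z) by move=> x; rewrite delE arc_irr.
have dist1 a b w : w != a -> dist_le (del_vertex D b) a w 1 = del_vertex D b a w.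
  by move=> na; rewrite dist_le1 // eq_sym.
have dist2P a b w : w != b -> reflect (del_vertex D a b w \/
    exists2 z, del_vertex D a b z & del_vertex D a z w)
    (dist_le (del_vertex D a) b w 2).
  by move=> nb; apply: dist_le2P; rewrite // eq_sym.
(* This treats the first disjunct of [c12]; the second one is the same with [u] and [v]
   exchanged. *)
have fwd a b w : a != b -> w != a -> w != b ->
    dist_le (del_vertex D b) a w 1 -> dist_le (del_vertex D a) b w 2 ->
    ((a \in A) = (b \in A) /\ exists2 w, D a w & D b w) \/
    ((a \in A) != (b \in A) /\ exists x y, [/\ D a y, y != b, D b x & x != a]).
  move=> nab na nb; rewrite dist1 // delE => /and3P[daw _ _] /dist2P[] //.
    case/and3P=> dbw _ _; left; split; last by exists w.
    by apply: negb_inj; rewrite -(arc_side _ _ daw) (arc_side _ _ dbw).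
  case=> z /and3P[dbz _ nza] /and3P[dzw _ _]; right; split.
    move: (arc_side _ _ daw); rewrite (arc_side _ _ dzw) (arc_side _ _ dbz).
    by case: (a \in A); case: (b \in A).
  by exists z, w; split.
apply: (iffP andP) => -[nuv].
  case/existsP=> w /and3P[nu nv /orP[]/andP[h1 h2]]; split=> //.
    exact: fwd h1 h2.
  rewrite eq_sym in nuv; case: (fwd _ _ _ nuv nv nu h1 h2) => -[hs].
    by case=> t d1 d2; left; split=> //; exists t.
  by case=> x [y [d1 n1 d2 n2]]; right; split; [rewrite eq_sym | exists y, x].
have arc_neq x y : D x y -> y != x.
  by move=> d; apply/eqP => e; rewrite e arc_irr in d.
case=> -[hs].
  case=> w du dv; split=> //; apply/existsP; exists w.
  have [nu nv] := (arc_neq _ _ du, arc_neq _ _ dv).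
  rewrite nu nv dist1 //=; apply/orP; left.
  rewrite delE du nuv nv; apply/dist2P => //; left.
  by rewrite delE dv nu eq_sym nuv.
case=> x [y [duy nyv dvx nxu]]; split=> //; apply/existsP.
have [nyu nxv] := (arc_neq _ _ duy, arc_neq _ _ dvx).
have sxy : (x \in A) != (y \in A).
  by rewrite (arc_side _ _ duy) (arc_side _ _ dvx); move: hs;
    case: (u \in A); case: (v \in A).
have [dxy|ndxy] := boolP (D x y).
  exists y; rewrite nyu nyv /= dist1 //; apply/orP; left.
  rewrite delE duy nuv nyv; apply/dist2P => //; right; exists x; rewrite delE.
    by rewrite dvx nxu eq_sym nuv.
  by rewrite dxy nxu nyu.
have dyx : D y x by rewrite arc_opp.
exists x; rewrite nxu nxv /= (dist1 v u) //; apply/orP; right.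
rewrite delE dvx nxu eq_sym nuv; apply/dist2P => //; right; exists y; rewrite delE.
  by rewrite duy nyv nuv.
by rewrite dyx nxv nyv.
Qed.

Lemma c12_same u v w :
  u != v -> (u \in A) = (v \in A) -> D u w -> D v w -> c12 D u v.
Proof. by move=> n s d1 d2; apply/c12P; split=> //; left; split=> //; exists w. Qed.

Lemma c12_opp u v x y : (u \in A) != (v \in A) ->
  D u y -> y != v -> D v x -> x != u -> c12 D u v.
Proof.
move=> s d1 n1 d2 n2; apply/c12P; split; first by apply: contraNneq s => ->.
by right; split=> //; exists x, y.
Qed.

Lemma c12_sym : symmetric (c12 D).
Proof.
suff imp u v : c12 D u v -> c12 D v u by move=> u v; apply/idP/idP; apply: imp.
case/c12P=> n [[s [w d1 d2]]|[s [x [y [d1 n1 d2 n2]]]]].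
  by apply: (c12_same _ _ w); rewrite // eq_sym.
by apply: (c12_opp _ _ y x); rewrite // eq_sym.
Qed.

Lemma c12_out u v : c12 D u v -> exists y, D u y.
Proof. by case/c12P=> n [[_ [w d _]]|[_ [x [y [d _ _ _]]]]]; [exists w|exists y]. Qed.

Lemma connect_c12_sym u v : connect (c12 D) u v = connect (c12 D) v u.
Proof. exact: sym_connect_sym c12_sym u v. Qed.

(** * Vertices with two out-neighbours *)

Definition big u := exists y y', [/\ D u y, D u y' & y != y'].

Lemma big_other u v : big u -> exists2 y, D u y & y != v.
Proof.
case=> y [y' [d d' n]]; have [e|nv] := eqVneq y v; last by exists y.
by exists y'; rewrite // -e eq_sym.
Qed.

Lemma c12_big u v : (u \in A) != (v \in A) -> big u -> big v -> c12 D u v.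
Proof.
move=> s /(big_other _ v)[y d1 n1] /(big_other _ u)[x d2 n2].
exact: c12_opp s d1 n1 d2 n2.
Qed.

Lemma nonbig_out u y y' : ~ big u -> D u y -> D u y' -> y = y'.
Proof.
by move=> nb d d'; apply/eqP/negPn/negP => n; case: nb; exists y, y'.
Qed.

(** A boolean form of [big], usable in [pickP] and in case distinctions. *)
Definition bigb u := [exists y, exists y', [&& D u y, D u y' & y != y']].

Lemma bigP u : reflect (big u) (bigb u).
Proof.
apply: (iffP existsP) => [[y /existsP[y' /and3P[d d' n]]]|[y [y' [d d' n]]]].
  by exists y, y'.
by exists y; apply/existsP; exists y'; rewrite d d'.
Qed.

(** Big vertices on different sides are adjacent, so [b'] links all big vertices of [A] to [b]. A
    non-big [u] turns out to be adjacent to some big vertex. *)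
Lemma connect_big u u' b b' : u \in A -> c12 D u u' ->
  b \in A -> big b -> b' \notin A -> big b' -> connect (c12 D) u b.
Proof.
move=> uA cu bA Bb b'A Bb'.
have opp x y : x \in A -> y \notin A -> (x \in A) != (y \in A).
  by move=> -> /negPf->.
have b'b y : y \notin A -> big y -> connect (c12 D) y b.
  by move=> yA By; rewrite connect_c12_sym; apply/connect1/c12_big => //; apply: opp.
have bb x : x \in A -> big x -> connect (c12 D) x b.
  move=> xA Bx; apply: connect_trans (b'b _ b'A Bb').
  by apply/connect1/c12_big => //; apply: opp.
have [/bb|sm] := bigP u; first exact.
have [v duv] := c12_out _ _ cu.
have vA : v \notin A by rewrite (arc_side _ _ duv) uA.
have back w : w \notin A -> w != v -> D w u.
  move=> wA nwv; rewrite arc_opp ?opp //.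
  by apply: contraNN nwv => duw; apply/eqP; apply: (nonbig_out _ _ _ sm).
(* Here [v] is the only out-neighbour of [u]. A big [w != v] outside [A] has an out-neighbour other
   than [u], hence is adjacent to [u]. *)
have [w /and3P[wA nwv /bigP Bw]|small] :=
    pickP [pred w | [&& w \notin A, w != v & bigb w]].
  apply: connect_trans (b'b _ wA Bw); apply: connect1.
  have [x dwx nxu] := big_other _ u Bw.
  by apply: (c12_opp _ _ x v); rewrite ?opp // eq_sym.
(* From here on each [w != v] outside [A] has [u] as its only out-neighbour. This makes a same-side
   neighbour [u'] of [u] big, and excludes a neighbour on the other side. *)
have smw w : w \notin A -> w != v -> ~ big w.
  by move=> wA nwv /bigP Bw; move: (small w); rewrite /= wA nwv Bw.
case/c12P: cu => nuu' [[su [t dut du't]]|[su [x [y [duy nyu' du'x nxu]]]]].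
  have u'A : u' \in A by rewrite -su.
  have ev : t = v := nonbig_out _ _ _ sm dut duv.
  have [w dbw nwv] := big_other _ v Bb.
  have wA : w \notin A by rewrite (arc_side _ _ dbw) bA.
  have du'w : D u' w.
    rewrite arc_opp; last by rewrite eq_sym opp.
    apply/negP => dwu'; move/eqP: nuu'; apply.
    exact: (nonbig_out _ _ _ (smw _ wA nwv) (back _ wA nwv) dwu').
  apply: (connect_trans (y := u')).
    by apply/connect1/(c12_same _ _ t).
  by apply: bb => //; exists t, w; split; rewrite // ev eq_sym.
have ev : y = v := nonbig_out _ _ _ sm duy duv.
have u'A : u' \notin A by move: su; rewrite uA; case: (u' \in A).
have nu'v : u' != v by rewrite -ev eq_sym.
by case: (smw _ u'A nu'v); exists x, u; split; rewrite // back.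
Qed.

(** The lone vertex [y] is isolated: a neighbour would lie in [A] and need an out-neighbour other
    than [y]. All other non-isolated vertices share the out-neighbour [y]. *)
Lemma connect_single_side y u v u' v' : y \notin A ->
  (forall z, z \notin A -> z = y) ->
  c12 D u u' -> c12 D v v' -> connect (c12 D) u v.
Proof.
move=> yA only.
have toy x z : D x z -> x \in A -> z = y.
  by move=> d xA; apply: only; rewrite (arc_side _ _ d) xA.
have inA w w' : c12 D w w' -> w \in A /\ D w y.
  move=> cw; have [wA|wA] := boolP (w \in A).
    by split=> //; have [z d] := c12_out _ _ cw; rewrite -(toy _ _ d).
  case/c12P: cw => nww' [[s _]|[s [x [z [_ _ d n]]]]].
    by move/eqP: nww'; case; rewrite (only w) // (only w') // -s.
  have w'A : w' \in A by move: s wA; case: (w \in A); case: (w' \in A).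
  by move/eqP: n; case; rewrite (toy _ _ d) // (only w).
move=> /inA[uA du] /inA[vA dv]; have [->|n] := eqVneq u v; first exact: connect0.
by apply/connect1/(c12_same _ _ y); rewrite // uA vA.
Qed.

(** * No big vertex in [A] *)

Section NoBig.
Hypothesis no_big : forall x, x \in A -> ~ big x.

Lemma out_unique x y y' : x \in A -> D x y -> D x y' -> y = y'.
Proof. by move/no_big; exact: nonbig_out. Qed.

Lemma arc_back x y : x \in A -> y \notin A -> ~~ D x y -> D y x.
Proof. by move=> xA yA n; rewrite arc_opp // xA (negPf yA). Qed.

Lemma arc_back_neq x v y : x \in A -> D x v -> y \notin A -> y != v -> D y x.
Proof.
move=> xA d yA n; apply: arc_back => //; apply: contraNN n => d'.
by apply/eqP; apply: (out_unique _ _ _ xA).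
Qed.

(** This reduces connectedness of the non-isolated vertices to that of the vertices of [A] having an
    out-neighbour. *)
Lemma connect_to_A x1 v x2 u u' : x1 \in A -> D x1 v -> x2 \in A -> x2 != x1 ->
  c12 D u u' -> exists x w, [/\ x \in A, D x w & connect (c12 D) u x].
Proof.
move=> x1A d1 x2A n21 cu; have [uA|uA] := boolP (u \in A).
  by have [w d] := c12_out _ _ cu; exists u, w.
have opp t x : t \notin A -> x \in A -> (t \in A) != (x \in A).
  by move=> /negPf-> ->.
have cuu' := cu; case/c12P: cu => n [[s [x dux du'x]]|[s [x [y [_ _ d _]]]]]; last first.
  exists u', x; split; [|exact: d|exact: connect1].
  by move: s uA; case: (u \in A); case: (u' \in A).
have u'A : u' \notin A by rewrite -s.
have xA : x \in A by rewrite (arc_side _ _ dux).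
(* Since [u] and [u'] are adjacent, it is enough that one of them has a suitable neighbour in
   [A]. *)
suff [t [a [w [tuu' aA daw cta]]]] : exists t a w,
    [/\ t \in [:: u; u'], a \in A, D a w & c12 D t a].
  exists a, w; split=> //; move: tuu'; rewrite !inE => /orP[]/eqP e; subst t.
    exact: connect1.
  exact: connect_trans (connect1 cuu') (connect1 cta).
(* If the common out-neighbour [x] is not a sink, any other [x'] in [A] misses [u] or [u']; the
   missed one has an arc to [x'] and is adjacent to [x]. *)
have [w dxw|sink] := pickP (D x).
  have [x' x'A nx'] : exists2 x', x' \in A & x' != x.
    by have [<-|] := eqVneq x1 x; [exists x2 | exists x1].
  have nwt t : D t x -> w != t.
    by move=> dt; apply: contraTneq dt => <-; rewrite arc_asym.
  have [dx'u|nd] := boolP (D x' u).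
    have du'x' : D u' x' by apply: (arc_back_neq _ u) => //; rewrite eq_sym.
    exists u', x, w; rewrite !inE eqxx orbT; split=> //.
    by apply: (c12_opp _ _ w x'); rewrite ?opp ?nwt // eq_sym nwt.
  have dux' : D u x' by exact: arc_back.
  exists u, x, w; rewrite !inE eqxx; split=> //.
  by rewrite c12_sym; apply: (c12_opp _ _ x' w); rewrite ?nwt // eq_sym opp.
(* If [x] is a sink, whichever of [u], [u'] differs from [v] is adjacent to [x1], through the arcs
   to [x] and from [x1] to [v]. *)
have nx1 : x != x1 by apply: contraFneq (sink v) => ->.
have out t : t \notin A -> D t x -> t != v -> c12 D t x1.
  move=> tA dtx ntv; rewrite c12_sym.
  by apply: (c12_opp _ _ x v); rewrite // 1?eq_sym ?opp.
have [e|nv] := eqVneq u v.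
  exists u', x1, v; rewrite !inE eqxx orbT; split=> //.
  by apply: out; rewrite // -e eq_sym.
by exists u, x1, v; rewrite !inE eqxx; split=> //; apply: out.
Qed.

Lemma connect_nonisolated a a' : a \in A -> a' \in A -> a != a' ->
  (forall x x' v v', x \in A -> x' \in A -> D x v -> D x' v' ->
     connect (c12 D) x x') ->
  forall u v u' v', c12 D u u' -> c12 D v v' -> connect (c12 D) u v.
Proof.
move=> aA a'A naa' conn u v u' v' cu cv.
have [x1 /andP[x1A /existsP[v1 d1]]|none] :=
    pickP [pred x | (x \in A) && [exists v, D x v]].
  have [x2 x2A n21] : exists2 x2, x2 \in A & x2 != x1.
    by have [<-|] := eqVneq a x1; [exists a'; rewrite // eq_sym | exists a].
  have [x [w [xA dx cx]]] := connect_to_A _ _ _ _ _ x1A d1 x2A n21 cu.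
  have [y [t [yA dy cy]]] := connect_to_A _ _ _ _ _ x1A d1 x2A n21 cv.
  apply: connect_trans cx (connect_trans (conn _ _ _ _ xA yA dx dy) _).
  by rewrite connect_c12_sym.
(* Now all of [A] consists of sinks: non-isolated vertices lie outside [A] and share the
   out-neighbour [a]. *)
have sink x w : x \in A -> D x w = false.
  move=> xA; apply/negP => d; move: (none x); rewrite /= xA => /existsP[].
  by exists w.
have notA t t' : c12 D t t' -> t \notin A.
  by move/c12_out=> [w d]; apply/negP => tA; rewrite sink in d.
have [->|n] := eqVneq u v; first exact: connect0.
have [uA vA] := (notA _ _ cu, notA _ _ cv).
by apply/connect1/(c12_same _ _ a); rewrite ?(negPf uA) ?(negPf vA) // arc_back ?sink.
Qed.

Lemma connect_third : (forall v v', exists y, [/\ y \notin A, y != v & y != v']) ->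
  forall x x' v v', x \in A -> x' \in A -> D x v -> D x' v' ->
     connect (c12 D) x x'.
Proof.
move=> third x x' v v' xA x'A d d'.
have [->|n] := eqVneq x x'; first exact: connect0.
have [y [yA nv nv']] := third v v'.
(* As [y] is not an out-neighbour of [a'], it has an arc to [a']; together with the arc from [a] to
   [w] this makes [a] and [y] adjacent. *)
have adj a a' w w' : a \in A -> a' \in A -> D a w -> D a' w' -> y != w -> y != w' ->
    a != a' -> c12 D a y.
  move=> aA a'A da da' nw nw' na; apply: (c12_opp _ _ a' w).
  - by rewrite aA (negPf yA).
  - by [].
  - by rewrite eq_sym.
  - exact: (arc_back_neq _ _ _ a'A da').
  - by rewrite eq_sym.
apply: (connect_trans (y := y)); first by apply/connect1/(adj x x' v v').
by rewrite connect_c12_sym; apply/connect1/(adj x' x v' v); rewrite // eq_sym.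
Qed.

(** * Exactly two vertices outside [A] *)

Section TwoVertices.
Variables (y1 y2 : V).
Hypotheses (n12 : y1 != y2) (y1A : y1 \notin A) (y2A : y2 \notin A).
Hypothesis only : forall z, z \notin A -> z = y1 \/ z = y2.

Lemma connect_sink x0 : x0 \in A -> (forall y, ~~ D x0 y) ->
  forall x x' v v', x \in A -> x' \in A -> D x v -> D x' v' ->
     connect (c12 D) x x'.
Proof.
move=> x0A sink.
have c12y : c12 D y1 y2.
  by apply: (c12_same _ _ x0); rewrite ?(negPf y1A) ?(negPf y2A) // arc_back.
suff toy x v : x \in A -> D x v -> connect (c12 D) x y1.
  move=> x x' v v' xA x'A d d'; apply: connect_trans (toy _ _ xA d) _.
  by rewrite connect_c12_sym; apply: toy d'.
move=> xA d.
have nx0 : x0 != x by apply: contraTneq d => <-; apply: sink.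
(* The out-neighbours used are [v] for [x] and the sink [x0] for [y]. *)
have adj y : y \notin A -> y != v -> c12 D x y.
  move=> yA nyv; apply: (c12_opp _ _ x0 v) => //; first by rewrite xA (negPf yA).
    by rewrite eq_sym.
  exact: arc_back.
have [e|n] := eqVneq y1 v; last by apply/connect1/adj.
apply: (connect_trans (y := y2)).
  by apply/connect1/adj; rewrite // -e eq_sym.
by rewrite connect_c12_sym; apply: connect1.
Qed.

Hypothesis total : forall x, x \in A -> D x y1 \/ D x y2.

(** Each vertex of [A] has an arc to [y1] or [y2], so it cannot receive arcs from both. *)
Lemma no_common_out : ~~ c12 D y1 y2.
Proof.
apply/negP => /c12P[_ [][]]; last by rewrite (negPf y1A) (negPf y2A).
move=> _ [w d1 d2]; have wA : w \in A by rewrite (arc_side _ _ d1).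
by case: (total _ wA); rewrite arc_asym.
Qed.

Lemma in_arc w : D y2 w -> D w y1.
Proof.
move=> d; have wA : w \in A by rewrite (arc_side _ _ d).
by case: (total _ wA) => //; rewrite arc_asym.
Qed.

(** When the fibre over [y1] has at most one element, that element and [y2] are isolated. So [u]
    lies in the fibre over [y2], or is [y1] and has a neighbour there. *)
Lemma connect_fiber u u' :
  (forall x x', D x y1 -> D x' y1 -> x = x') ->
  c12 D u u' -> exists2 x, D x y2 & connect (c12 D) u x.
Proof.
move=> single cu; have [uA|uA] := boolP (u \in A).
  case: (total _ uA) => du; last by exists u.
  case/c12P: cu => n [[s [w d d']]|[s [x [y [d ny d' nx]]]]].
    have e : w = y1 := out_unique _ _ _ uA d du.
    by move/eqP: n; case; apply: single; rewrite -?e.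
  have u'A : u' \notin A by move: s; rewrite uA; case: (u' \in A).
  have e : y = y1 := out_unique _ _ _ uA d du.
  case: (only _ u'A) => e'; first by move/eqP: ny; rewrite e e'.
  by move/eqP: nx; case; apply: single => //; apply: in_arc; rewrite -e'.
have adj := cu.
case/c12P: cu => n [[s _]|[s [x [y [d ny d' nx]]]]].
  have u'A : u' \notin A by rewrite -s.
  case: (only _ uA) (only _ u'A) => e [] e'; move: n adj no_common_out;
    by rewrite e e' ?eqxx // c12_sym => _ ->.
have u'A : u' \in A by move: s uA; case: (u \in A); case: (u' \in A).
case: (total _ u'A) => du'; last by exists u'; rewrite // connect1.
have e : x = y1 := out_unique _ _ _ u'A d' du'.
case: (only _ uA) => e'; first by move/eqP: nx; rewrite e e'.
by move/eqP: ny; case; apply: single => //; apply: in_arc; rewrite -e'.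
Qed.

Lemma connect_single_fiber :
  (forall x x', D x y1 -> D x' y1 -> x = x') ->
  forall u v u' v', c12 D u u' -> c12 D v v' -> connect (c12 D) u v.
Proof.
move=> single u v u' v' /(connect_fiber _ _ single)[x dx cx].
case/(connect_fiber _ _ single)=> y dy cy.
have inA w : D w y2 -> w \in A.
  by move/arc_side=> e; move: y2A; rewrite e negbK.
apply: connect_trans cx _; rewrite connect_c12_sym.
apply: connect_trans cy _; have [->|n] := eqVneq y x; first exact: connect0.
by apply/connect1/(c12_same _ _ y2); rewrite ?inA.
Qed.

End TwoVertices.

(** The fibre over [y] is joined with the other vertex [y']: an element whose only out-neighbour is
    [y] cannot be adjacent to [y] itself. *)
Definition fiber_class y y' : {set V} := [set z | D z y || (z == y')].

Section TwoCliques.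
Variables (y1 y2 : V).
Hypotheses (n12 : y1 != y2) (y1A : y1 \notin A) (y2A : y2 \notin A).
Hypothesis only : forall z, z \notin A -> z = y1 \/ z = y2.
Hypothesis total : forall x, x \in A -> D x y1 \/ D x y2.

Lemma to_y_inA y w : y \notin A -> D w y -> w \in A.
Proof. by move=> yA /arc_side e; move: yA; rewrite e negbK. Qed.

Lemma fiber_classC : fiber_class y2 y1 = ~: fiber_class y1 y2.
Proof.
apply/setP => z; rewrite !inE; have [zA|zA] := boolP (z \in A).
  have -> : (z == y1) = false by apply: contraNF y1A => /eqP <-.
  have -> : (z == y2) = false by apply: contraNF y2A => /eqP <-.
  rewrite !orbF; case: (total _ zA) => d; rewrite d.
    by apply/negP => /(out_unique _ _ _ zA d)/eqP; rewrite (negPf n12).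
  by apply/esym/negP => d'; move/(out_unique _ _ _ zA d)/eqP: d';
    rewrite eq_sym (negPf n12).
have -> : D z y1 = false by apply: contraNF zA; apply: to_y_inA.
have -> : D z y2 = false by apply: contraNF zA; apply: to_y_inA.
by case: (only _ zA) => ->; rewrite !eqxx ?(negPf n12) // eq_sym (negPf n12).
Qed.

(** Elements of the fibre share the out-neighbour [y1]. For [x] in the fibre and [y2], the arcs are
    from [x] to [y1] and from [y2] to a second element of the fibre. *)
Lemma fiber_class_clique x1 x1' : D x1 y1 -> D x1' y1 -> x1 != x1' ->
  {in fiber_class y1 y2 &, forall x y, x != y -> c12 D x y}.
Proof.
move=> d1 d1' n1.
have y2x x : D x y1 -> c12 D x y2.
  move=> d; have xA := to_y_inA _ _ y1A d.
  have [x' d' n'] : exists2 x', D x' y1 & x' != x.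
    by have [<-|] := eqVneq x1 x; [exists x1'; rewrite // eq_sym | exists x1].
  apply: (c12_opp _ _ x' y1) => //; first by rewrite xA (negPf y2A).
  by apply: (arc_back_neq _ _ _ (to_y_inA _ _ y1A d') d'); rewrite // eq_sym.
move=> x y; rewrite !inE => /orP[dx|/eqP->] /orP[dy|/eqP->] n.
- by apply: (c12_same _ _ y1); rewrite // (to_y_inA _ _ y1A dx) (to_y_inA _ _ y1A dy).
- exact: y2x.
- by rewrite c12_sym; apply: y2x.
- by rewrite eqxx in n.
Qed.

End TwoCliques.

(** Elements of different fibres have no common out-neighbour, an element of a fibre is not adjacent
    to its own base point, and [no_common_out] settles [y1] and [y2]. *)
Lemma fiber_class_sep y1 y2 x y : y1 != y2 -> y1 \notin A -> y2 \notin A ->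
  (forall x, x \in A -> D x y1 \/ D x y2) ->
  x \in fiber_class y1 y2 -> y \in fiber_class y2 y1 -> ~~ c12 D x y.
Proof.
move=> n12 y1A y2A total; rewrite !inE.
have sep z1 a : z1 \notin A -> D a z1 -> ~~ c12 D a z1.
  move=> z1A da; apply/negP => /c12P[_].
  have aA := to_y_inA _ _ z1A da; rewrite aA (negPf z1A).
  case=> -[// _ [x' [y' [d nd _ _]]]].
  by rewrite (out_unique _ _ _ aA d da) eqxx in nd.
case/orP=> [dx|/eqP->] /orP[dy|/eqP->].
- apply/negP => /c12P[_ []].
    case=> _ [w d d']; have [xA yA] := (to_y_inA _ _ y1A dx, to_y_inA _ _ y2A dy).
    move: n12; rewrite -(out_unique _ _ _ xA d dx) -(out_unique _ _ _ yA d' dy).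
    by rewrite eqxx.
  by rewrite (to_y_inA _ _ y1A dx) (to_y_inA _ _ y2A dy) => -[].
- exact: sep y1A dx.
- by rewrite c12_sym; apply: sep y2A dy.
- by rewrite c12_sym; apply: no_common_out.
Qed.

Lemma two_cliques y1 y2 x1 x1' x2 x2' : y1 != y2 -> y1 \notin A -> y2 \notin A ->
  (forall z, z \notin A -> z = y1 \/ z = y2) ->
  (forall x, x \in A -> D x y1 \/ D x y2) ->
  D x1 y1 -> D x1' y1 -> x1 != x1' -> D x2 y2 -> D x2' y2 -> x2 != x2' ->
  #|components (c12 D)| = 2 /\
  forall K : {set V}, K \in components (c12 D) -> 3 <= #|K| /\ complete_on (c12 D) K.
Proof.
move=> n12 y1A y2A only total d1 d1' n1 d2 d2' n2.
have n21 : y2 != y1 by rewrite eq_sym.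
have total' z : z \in A -> D z y2 \/ D z y1 by case/total; [right|left].
have KC := fiber_classC _ _ n12 y1A y2A only total.
have cl1 := fiber_class_clique _ _ n12 y1A y2A _ _ d1 d1' n1.
have cl2 := fiber_class_clique _ _ n21 y2A y1A _ _ d2 d2' n2.
have sep12 := fiber_class_sep _ _ _ _ n12 y1A y2A total.
have sep21 := fiber_class_sep _ _ _ _ n21 y2A y1A total'.
have cE x y : c12 D x y =
    (x != y) && ((x \in fiber_class y1 y2) == (y \in fiber_class y1 y2)).
  have [->|n] := eqVneq x y; first by apply/negbTE/negP => /c12P[]; rewrite eqxx.
  have inC z : (z \notin fiber_class y1 y2) = (z \in fiber_class y2 y1).
    by rewrite KC in_setC.
  have [xK|xK] := boolP (x \in fiber_class y1 y2);
    have [yK|yK] := boolP (y \in fiber_class y1 y2) => /=.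
  - exact: cl1.
  - by apply/negbTE/sep12 => //; rewrite -inC.
  - by apply/negbTE/sep21 => //; rewrite -inC.
  - by apply: cl2; rewrite // -inC.
have y2K : y2 \in fiber_class y1 y2 by rewrite inE eqxx orbT.
have y1K : y1 \notin fiber_class y1 y2 by rewrite inE arc_irr (negPf n12).
(* Two elements of the fibre and the extra vertex [y'] make three. *)
have big_class y y' x x' : y' \notin A -> y \notin A -> D x y -> D x' y -> x != x' ->
    3 <= #|fiber_class y y'|.
  move=> y'A yA d d' n; apply/card_gt2P; exists x, x', y'; split; split.
  1,2,3: by rewrite inE ?d ?d' ?eqxx ?orbT.
  - by [].
  - by apply: contraNneq y'A => <-; apply: to_y_inA yA d'.
  - by apply: contraNneq y'A => ->; apply: to_y_inA yA d.
rewrite (components_two_cliques _ _ _ _ _ y2K y1K cE) -KC; split.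
  rewrite cards2; suff -> : fiber_class y1 y2 != fiber_class y2 y1 by [].
  by apply: contraTneq y2K => ->; rewrite KC in_setC inE eqxx orbT.
move=> K; rewrite !inE => /orP[]/eqP->; split=> //.
  by apply: big_class d1 d1' n1.
by apply: big_class d2 d2' n2.
Qed.

(** * The case distinction *)

Lemma no_big_side a a' b b' : a \in A -> a' \in A -> a != a' ->
    b \notin A -> b' \notin A -> b != b' ->
  #|nontrivial_components (c12 D)| <= 1 \/
  (#|components (c12 D)| = 2 /\
   forall K : {set V}, K \in components (c12 D) ->
     3 <= #|K| /\ complete_on (c12 D) K).
Proof.
move=> aA a'A naa' bA b'A nbb'.
have [c /and3P[cA ncb ncb']|two] :=
    pickP [pred c | [&& c \notin A, c != b & c != b']].
  left; apply: nontrivial_components_le1 c12_sym _.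
  apply: connect_nonisolated aA a'A naa' _; apply: connect_third => v v'.
  (* One of [b], [b'], [c] avoids both [v] and [v']; if [b] and [b'] do not, they exhaust these two
     values and [c] is left. *)
  have [/andP[nv nv']|hb] := boolP ((b != v) && (b != v')); first by exists b.
  have [/andP[nv nv']|hb'] := boolP ((b' != v) && (b' != v')); first by exists b'.
  exists c; split=> //; move: hb hb'; rewrite !negb_and !negbK;
    by case/orP=> /eqP e /orP[]/eqP e'; subst; rewrite ?eqxx // in nbb' ncb ncb' *.
have only z : z \notin A -> z = b \/ z = b'.
  move=> zA; move: (two z); rewrite /= zA /=.
  by have [->|_] := eqVneq z b; [left | have [->|] := eqVneq z b'; [right|]].
have [x0 /andP[x0A /forallP sink]|nosink] :=
    pickP [pred x | (x \in A) && [forall y, ~~ D x y]].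
  left; apply: nontrivial_components_le1 c12_sym _.
  apply: connect_nonisolated aA a'A naa' _.
  exact: (connect_sink b b' nbb' bA b'A x0).
have total x : x \in A -> D x b \/ D x b'.
  move=> xA; move: (nosink x); rewrite /= xA /= => /negbT/forallPn[y].
  rewrite negbK => d; have yA : y \notin A by rewrite (arc_side _ _ d) xA.
  by case: (only _ yA) => <-; [left|right].
have total' x : x \in A -> D x b' \/ D x b by case/total; [right|left].
have only' z : z \notin A -> z = b' \/ z = b by case/only; [right|left].
have fibers y : (exists x x', [/\ D x y, D x' y & x != x']) \/
    forall x x', D x y -> D x' y -> x = x'.
  have [/card_gt1P[x [x' [d d' n]]]|le1] := ltnP 1 #|[pred x | D x y]|.
    by left; exists x, x'.
  by right=> x x' d d'; apply: (card_le1_eqP le1).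
case: (fibers b) => [[x1 [x1' [d1 d1' n1]]]|single].
  case: (fibers b') => [[x2 [x2' [d2 d2' n2]]]|single].
    by right; apply: (two_cliques b b' x1 x1' x2 x2').
  left; apply: nontrivial_components_le1 c12_sym _.
  by apply: (connect_single_fiber b' b).
left; apply: nontrivial_components_le1 c12_sym _.
by apply: (connect_single_fiber b b').
Qed.

End NoBig.
End Bipartite.

Theorem theorem2p8 (V : finType) (D : rel V) (hD : bipartite_tournament D) :
  #|nontrivial_components (c12 D)| <= 1 \/
  (#|components (c12 D)| = 2 /\
   forall K : {set V}, K \in components (c12 D) ->
     3 <= #|K| /\ complete_on (c12 D) K).
Proof.
case: hD => A [/set0Pn[a aA] /set0Pn[b]]; rewrite inE => bA same opp.
have bipA : bipartition D A by [].
have bipC := bipartitionC _ _ _ bipA.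
(* First the case [A = [set a]], handled with the sides exchanged. *)
have [a' /andP[a'A na]|oneA] := pickP [pred x | (x \in A) && (x != a)]; last first.
  left; apply: (nontrivial_components_le1 _ _ (c12_sym _ _ _ bipA)) => u v u' v'.
  apply: (connect_single_side _ _ _ bipC a); first by rewrite inE aA.
  move=> z; rewrite inE negbK => zA; apply/eqP/negPn/negP => n.
  by move: (oneA z); rewrite /= zA n.
have [b' /andP[b'A nb]|oneB] := pickP [pred x | (x \notin A) && (x != b)]; last first.
  left; apply: (nontrivial_components_le1 _ _ (c12_sym _ _ _ bipA)) => u v u' v'.
  apply: (connect_single_side _ _ _ bipA b) => // z zA.
  by apply/eqP/negPn/negP => n; move: (oneB z); rewrite /= zA n.
have [x /andP[xA /bigP Bx]|nbA] :=
    pickP [pred u | (u \in A) && bigb _ D u]; last first.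
  apply: (no_big_side _ _ _ bipA _ a' a b' b) => // x xA /bigP Bx.
  by move: (nbA x); rewrite /= xA Bx.
have [y /andP[yA /bigP By]|nbB] :=
    pickP [pred u | (u \notin A) && bigb _ D u]; last first.
  apply: (no_big_side _ _ _ bipC _ b' b a' a); rewrite ?inE ?negbK // => y.
  by rewrite inE => yA /bigP By; move: (nbB y); rewrite /= yA By.
left; apply: (nontrivial_components_le1 _ _ (c12_sym _ _ _ bipA)).
have xy : connect (c12 D) y x.
  apply/connect1/(c12_big _ _ _ bipA) => //; by rewrite xA (negPf yA).
(* With big vertices [x] and [y] on both sides, [x] serves as a hub; a vertex outside [A] reaches it
   through [y]. *)
have tox u u' : c12 D u u' -> connect (c12 D) u x.
  move=> cu; have [uA|uA] := boolP (u \in A).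
    exact: connect_big bipA _ _ x y uA cu xA Bx yA By.
  apply: connect_trans xy; apply: (connect_big _ _ _ bipC u u' y x);
    by rewrite ?inE ?negbK.
move=> u v u' v' /tox cu /tox cv; apply: connect_trans cu _.
by rewrite (connect_c12_sym _ _ _ bipA).
Qed.
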